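(* Let $a>0$, $0<\epsilon<1$ and $h(x)=1+\epsilon\cos(2x)$. Then there exists one and only one $P\in H^1_0(0,\pi)$ solving (in the weak sense given in the context) the problem $$-\big(h^3(x)P'(x)\big)'+\sum_{n=1}^\infty n\coth(na)\,b_n\sin(nx)=h'(x)\ \text{ in }(0,\pi),\qquad P(0)=0,\quad P(\pi)=0,$$ where $b_n=\frac2\pi\int_0^\pi P(\xi)\sin(n\xi)\,d\xi$.
   Context: Weak sense: $P\in H^1_0(0,\pi)$ is a solution if $$\int_0^\pi h^3(x)P'(x)V'(x)\,dx+\frac\pi2\sum_{n=1}^\infty n\coth(na)\,b_nc_n=\int_0^\pi h'(x)V(x)\,dx\qquad\text{for all }V\in H^1_0(0,\pi),$$ where $b_n=\frac2\pi\int_0^\pi P(\xi)\sin(n\xi)\,d\xi$ and $c_n=\frac2\pi\int_0^\pi V(\xi)\sin(n\xi)\,d\xi$ are the sine coefficients of $P$ and $V$. *)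

(* Defs.v *)
From HB Require Import structures.
From mathcomp Require Import all_boot all_order all_algebra.
From mathcomp Require Import all_classical all_reals all_analysis.

Set Implicit Arguments.
Unset Strict Implicit.
Unset Printing Implicit Defensive.

Import Order.TTheory GRing.Theory Num.Theory.
Import numFieldNormedType.Exports.

Local Open Scope ring_scope.
Local Open Scope classical_set_scope.

Definition coth {R : realType} (x : R) : R :=
  (expR x + expR (- x)) / (expR x - expR (- x)).

(* Lebesgue measure on (0, pi). Elements of function spaces on (0, pi) are
   represented by functions R -> R; their values outside (0, pi) are
   irrelevant and equality in these spaces is equality mu0pi-a.e. *)
Definition mu0pi (R : realType) : {measure set (measurableTypeR R) -> \bar R} :=
  mrestr (@lebesgue_measure R) (measurable_itv `]0, pi[%R).

(* C_c^oo(0, pi) *)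
Definition test_function {R : realType} (phi : R -> R) : Prop :=
  [/\ forall (n : nat) (x : R), derivable (phi^`(n)) x 1,
      compact (closure [set x | phi x != 0])
    & closure [set x | phi x != 0] `<=` `]0, pi[].

(* u \in H^1(0, pi), and u' is its weak derivative *)
Definition H1 {R : realType} (u u' : R -> R) : Prop :=
  [/\ u \in Lfun (mu0pi R) 2%:E,
      u' \in Lfun (mu0pi R) 2%:E
    & forall phi : R -> R, test_function phi ->
        \int[mu0pi R]_x (u x * phi^`()%classic x) = - \int[mu0pi R]_x (u' x * phi x)].

Definition L2_cvg {R : realType} (f : nat -> R -> R) (g : R -> R) : Prop :=
  ('N[mu0pi R]_2%:E [EFin \o (f k \- g)%R])%E @[k --> \oo] --> 0%E.

(* u \in H^1_0(0, pi), the closure of C_c^oo(0, pi) in H^1(0, pi), and u' is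
   its weak derivative. Since u' is determined by u up to a.e. equality,
   quantifying over pairs (u, u') with H10 u u' amounts to quantifying over
   u \in H^1_0(0, pi). *)
Definition H10 {R : realType} (u u' : R -> R) : Prop :=
  H1 u u' /\
  exists phi : nat -> R -> R,
    [/\ forall k, test_function (phi k),
        L2_cvg phi u
      & L2_cvg (fun k => (phi k)^`()) u'].

Definition sine_coef {R : realType} (u : R -> R) (n : nat) : R :=
  2 / pi * \int[mu0pi R]_x (u x * sin (n%:R * x)).

Definition gap {R : realType} (eps : R) (x : R) : R := 1 + eps * cos (2 * x).

Definition weak_solution {R : realType} (a : R) (h : R -> R) (P : R -> R) :
    Prop :=
  exists P' : R -> R, H10 P P' /\
  forall V V' : R -> R, H10 V V' ->
    let s (N : nat) : R := \sum_(1 <= n < N)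
      n%:R * coth (n%:R * a) * sine_coef P n * sine_coef V n in
    cvgn s /\
    \int[mu0pi R]_x (h x ^+ 3 * P' x * V' x) + pi / 2 * limn s
    = \int[mu0pi R]_x (h^`()%classic x * V x).

(* Main.v *)
(* The weak formulation reads E(P, V) = F(V) for the symmetric form
   E(u, v) = int h^3 u' v' + (pi / 2) sum_n n coth(n a) u_n v_n on H^1_0.
   Integrating by parts, n u_n = (2 / pi) int u' cos(n x), so Bessel's inequality
   and coth(n a) <= coth a give E(u, u) <= (8 + coth a) |u'|^2; as h >= 1 - eps
   and coth >= 0, also E(u, u) >= (1 - eps)^3 |u'|^2. With the Poincare
   inequality, E is equivalent to the H^1_0 inner product and F is bounded, so
   existence and uniqueness follow from Riesz representation: almost minimizers
   of E(v, v) - 2 F(v), chosen within 4^-k of the infimum, form a Cauchy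
   sequence, whose limit exists by completeness of L^2. *)
Require Import Defs.
From HB Require Import structures.
From mathcomp Require Import all_boot all_order all_algebra.
From mathcomp Require Import all_classical all_reals all_analysis.
From mathcomp Require Import measurable_realfun ring lra.

Set Implicit Arguments.
Unset Strict Implicit.
Unset Printing Implicit Defensive.

Import Order.TTheory GRing.Theory Num.Theory.
Import numFieldNormedType.Exports.

Local Open Scope ring_scope.
Local Open Scope classical_set_scope.

(** * Riesz representation for a complete semi-inner product *)

(** Elements of H^1_0 are plain functions, not classes modulo null sets, and the weak derivative is
    determined only almost everywhere. The Hilbert space argument is therefore run on pairs
    [(u, u')], where the energy is merely positive semidefinite; definiteness comes back only in the
    uniqueness proof, as almost everywhere equality. No topology is put on these pairs: limits are
    expressed by squared distances bounded by a constant times [4^-1 ^+ k]. Up to constants, this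
    rate survives the passage between the energy, the L^2 norm of derivatives and the L^2 norm of
    functions, and it makes the increments of a sequence summable in L^1, so that almost everywhere
    convergence needs no subsequence. Both energy bounds serve completeness: the lower one, with
    [1 - eps] positive, turns an energy-Cauchy sequence into one with Cauchy derivatives; the upper
    one turns convergence of derivatives back into convergence in energy. *)

Lemma discriminant_le (R : realFieldType) (a b c : R) :
  (forall t, 0 <= a + 2 * t * b + t ^+ 2 * c) -> b ^+ 2 <= a * c.
Proof.
move=> H.
have a0 : 0 <= a by move: (H 0); rewrite mulr0 mul0r expr0n mul0r !addr0.
have [c0|c0] := eqVneq c 0.
  rewrite c0 mulr0; have [->|b0] := eqVneq b 0; first by rewrite expr0n.
  (* At this point the remaining affine function of [t] takes the value [-1]. *)
  have := H (- (a + 1) / (2 * b)); rewrite c0 mulr0 addr0.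
  have -> : 2 * (- (a + 1) / (2 * b)) * b = - (a + 1) by field.
  by move=> ?; lra.
have cp : 0 < c.
  rewrite lt_neqAle eq_sym c0 /= leNgt; apply/negP => cn.
  (* Now [t >= 1] and [- c * t > a], so [a + t ^+ 2 * c < 0]; this contradicts the average of the
     hypothesis at [t] and [- t]. *)
  set t := (a + `|b| + 1) / - c + 1.
  have t1 : 1 <= t.
    by rewrite lerDr divr_ge0 ?oppr_ge0 ?(ltW cn)// !addr_ge0.
  have tc : - c * t = a + `|b| + 1 - c by rewrite /t; field.
  have := H t; have := H (- t); have := ler_norm b; have := ler_norm (- b).
  by rewrite normrN => *; nra.
have := H (- b / c).
have -> : a + 2 * (- b / c) * b + (- b / c) ^+ 2 * c = (a * c - b ^+ 2) / c.
  by field.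
by rewrite pmulr_lge0 ?invr_gt0// subr_ge0.
Qed.

(** Stands in for passing to the limit: a quantity free of [k] is estimated through the [k]-th
    approximation of some object. *)
Lemma le0_geometric (R : realType) (x C : R) :
  (forall k : nat, x <= C * 4^-1 ^+ k) -> x <= 0.
Proof.
move=> H; rewrite leNgt; apply/negP => x0.
have C0 : 0 < C by have := H 0%N; rewrite expr0 mulr1; exact: lt_le_trans.
pose q : R := 4^-1.
have q1 : `|q| < 1 by rewrite gtr0_norm ?invr_gt0// invf_lt1//; lra.
have : C * q ^+ n @[n --> \oo] --> C * 0 by apply: cvgMr; exact: cvg_expr.
rewrite mulr0 => /cvgrPdist_lt/(_ _ x0)[N _ /(_ N (leqnn N))] /=.
rewrite sub0r normrN gtr0_norm; last by rewrite mulr_gt0// exprn_gt0// invr_gt0.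
by rewrite ltNge H.
Qed.

Section riesz_representation.
Context {R : realType} {V : lmodType R} (D : set V) (E : V -> V -> R)
  (F : V -> R) (C : R).
Hypothesis D0 : D 0.
Hypothesis DL : forall c u v, D u -> D v -> D (c *: u + v).
Hypothesis EC : forall u v, D u -> D v -> E u v = E v u.
Hypothesis EL : forall c u v w, D u -> D v -> D w ->
  E (c *: u + v) w = c * E u w + E v w.
Hypothesis E_ge0 : forall u, D u -> 0 <= E u u.
Hypothesis FL : forall c u v, D u -> D v -> F (c *: u + v) = c * F u + F v.
Hypothesis C_ge0 : 0 <= C.
Hypothesis F_bound : forall u, D u -> F u ^+ 2 <= C * E u u.
(** Completeness is asked only for sequences with a geometric rate, and the constant may change from
    [K] to [K']: in the application the limit is taken in an equivalent norm. Since [E] may be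
    degenerate, [w] need not be unique. *)
Hypothesis complete : forall (v : nat -> V) (K : R), (forall k, D (v k)) ->
  (forall k l, (k <= l)%N -> E (v k - v l) (v k - v l) <= K * 4^-1 ^+ k) ->
  exists2 w, D w & exists K', forall k, E (v k - w) (v k - w) <= K' * 4^-1 ^+ k.

Let DB u v : D u -> D v -> D (u - v).
Proof. by move=> Du Dv; rewrite addrC -scaleN1r; exact: DL. Qed.

Let EB u v w : D u -> D v -> D w -> E (u - v) w = E u w - E v w.
Proof.
by move=> Du Dv Dw; rewrite addrC -scaleN1r EL// mulN1r addrC.
Qed.

Let E_CS u v : D u -> D v -> E u v ^+ 2 <= E u u * E v v.
Proof.
move=> Du Dv; apply: discriminant_le => t.
have Dtu : D (t *: v + u) by exact: DL.
have := E_ge0 Dtu; rewrite EL// (EC Dv)// (EC Du)// !EL// (EC Dv Du).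
by rewrite (_ : _ + _ = E u u + 2 * t * E u v + t ^+ 2 * E v v)//; ring.
Qed.

Let J u := E u u - 2 * F u.

(** Arithmetic-geometric mean: [(2 * F u) ^+ 2 <= 4 * C * E u u <= (C + E u u) ^+ 2], so
    [2 * F u <= C + E u u]. *)
Let J_lb u : D u -> - C <= J u.
Proof.
move=> Du; rewrite /J; have := C_ge0; have := F_bound Du; have := E_ge0 Du.
move: (E u u) (F u) => e f e0 fC C0; rewrite leNgt; apply/negP => lt.
have : (e + C) ^+ 2 < (2 * f) ^+ 2 by rewrite ltr_pXn2r// ?nnegrE; lra.
by have := sqr_ge0 (e - C); rewrite !expr2 in fC * => *; lra.
Qed.

(** An approximate Euler-Lagrange equation. If [v] minimizes [J] up to [d], comparison with
    [v + t w] gives [0 <= d + 2 t (E v w - F w) + t^2 E w w] for every [t], and the discriminant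
    bounds the residual. *)
Let almost_minimizer (k : nat) :
  exists2 v, D v & forall w, D w -> (E v w - F w) ^+ 2 <= 4^-1 ^+ k * E w w.
Proof.
have JD : has_inf (J @` D).
  split; first by exists (J 0), 0.
  by exists (- C) => _ [u Du <-]; exact: J_lb.
have k0 : 0 < 4^-1 ^+ k :> R by rewrite exprn_gt0// invr_gt0.
have [_ [v Dv <-] Jv] := inf_adherent k0 JD.
exists v => // w Dw; apply: discriminant_le => t.
have Dvw : D (t *: w + v) by exact: DL.
have : inf (J @` D) <= J (t *: w + v) by apply: ge_inf; [exact: JD.2|exists (t *: w + v)].
have -> : J (t *: w + v) = J v + 2 * t * (E v w - F w) + t ^+ 2 * E w w.
  rewrite /J FL// EL// (EC Dw)// (EC Dv)// !EL// (EC Dw Dv); ring.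
by move=> ?; lra.
Qed.

Lemma riesz_representation : exists2 v, D v & forall w, D w -> E v w = F w.
Proof.
have [v Hv] : exists v : nat -> V, forall k, D (v k) /\
    forall w, D w -> (E (v k) w - F w) ^+ 2 <= 4^-1 ^+ k * E w w.
  have H k : exists v, D v /\
      forall w, D w -> (E v w - F w) ^+ 2 <= 4^-1 ^+ k * E w w.
    by have [v] := almost_minimizer k; exists v.
  by exists (fun k => projT1 (cid (H k))) => k; case: cid.
have Dv k : D (v k) by have [] := Hv k.
have Ev k w : D w -> (E (v k) w - F w) ^+ 2 <= 4^-1 ^+ k * E w w.
  by have [_] := Hv k; exact.
(* Origin of the 4: with [w = v k - v l], the number [e = E w w] is a difference [r - s] of two
   residuals whose squares are at most [4^-1 ^+ k * e], so [e ^+ 2 <= 2 r^2 + 2 s^2 <= 4 * 4^-1 ^+ k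
   * e]. *)
have [||w Dw [K wK]] := @complete v 4 => //.
  move=> k l kl; set w := v k - v l.
  have Dw : D w by exact: DB.
  have lk : 4^-1 ^+ l <= 4^-1 ^+ k :> R.
    by rewrite ler_wiXn2l// ?invr_ge0// invf_le1//; lra.
  have := Ev k _ Dw; have := Ev l _ Dw; have := E_ge0 Dw.
  have : E w w = (E (v k) w - F w) - (E (v l) w - F w).
    by rewrite {1}/w EB//; ring.
  have : 0 <= 4^-1 ^+ k :> R by rewrite exprn_ge0// invr_ge0.
  move: (E w w) (E (v k) w - F w) (E (v l) w - F w) (4^-1 ^+ k) (4^-1 ^+ l) lk.
  move=> e r s d d' d'd d0 ers e0 sd rd.
  rewrite leNgt; apply/negP => lt.
  have ee : e * e <= 4 * d * e.
    have := sqr_ge0 (r + s); rewrite !expr2 in sd rd *; nra.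
  by nra.
exists w => // z Dz.
suff : (E w z - F z) ^+ 2 <= 0.
  by rewrite real_exprn_even_le0 ?num_real//= subr_eq0 => /eqP.
(* The residual of [w] is that of [v k] minus [E (v k - w) z]. The squares of these two are at most
   [E z z] and [K * E z z] times [4^-1 ^+ k], and [(r - s)^2 <= 2 r^2 + 2 s^2]. *)
apply: (@le0_geometric _ _ (2 * (E z z * (1 + K)))) => k.
have DB1 : D (v k - w) by exact: DB.
have -> : E w z - F z = (E (v k) z - F z) - E (v k - w) z by rewrite EB//; ring.
have := E_CS DB1 Dz; have := wK k; have := Ev k _ Dz; have := E_ge0 Dz.
move: (E (v k) z - F z) (E (v k - w) z) (E z z) (E (v k - w) (v k - w))
  (4^-1 ^+ k) => r s e f d e0 rd fd sf.
have := sqr_ge0 (r + s); rewrite !expr2 in rd sf *; nra.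
Qed.

End riesz_representation.

(** * The space L^2 *)

(** A real number for all functions, because the integral is truncated by [fine]. Symmetry and
    positivity thus hold unconditionally, while linearity asks for membership in L^2. *)
Definition dotp d (T : measurableType d) (R : realType)
  (mu : {measure set T -> \bar R}) (f g : T -> R) : R := \int[mu]_x (f x * g x).

Section L2.
Context d (T : measurableType d) (R : realType).
Variable mu : {measure set T -> \bar R}.
Local Notation L2 := (Lfun mu 2%:E).
Local Notation dot := (dotp mu).
Implicit Types f g h : T -> R.

Let le12 : (1 <= 2%:E :> \bar R)%E. Proof. by rewrite lee_fin; lra. Qed.

Lemma L2_measurable f : f \in L2 -> measurable_fun setT f.
Proof. by move=> /sub_Lfun_mfun; rewrite inE. Qed.

Lemma L2_integrableM f g : f \in L2 -> g \in L2 ->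
  mu.-integrable setT (EFin \o (fun x => f x * g x)).
Proof. by move=> lf lg; apply/Lfun1_integrable; exact: Lfun2_mul_Lfun1. Qed.

Lemma L2_linear c f g : f \in L2 -> g \in L2 -> c *: f + g \in L2.
Proof. by move=> lf lg; apply: (Lfun_submod_closed mu le12).2. Qed.

Lemma L2_0 : (0 : T -> R) \in L2.
Proof. exact: (Lfun_submod_closed mu le12).1. Qed.

Lemma L2_sub f g : f \in L2 -> g \in L2 -> f - g \in L2.
Proof. by move=> lf lg; rewrite addrC -scaleN1r; exact: L2_linear. Qed.

Lemma L2_scale c f : f \in L2 -> c *: f \in L2.
Proof. by move=> lf; rewrite -[X in X \in _]addr0 L2_linear// L2_0. Qed.

Lemma L2_sqr f : measurable_fun setT f ->
  mu.-integrable setT (EFin \o (fun x => f x ^+ 2)) -> f \in L2.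
Proof.
move=> mf /integrableP[_ fi]; rewrite inE; apply/andP; split; rewrite inE//=.
rewrite /finite_norm unlock; apply: poweR_lty.
rewrite (_ : (fun x => _) = (fun x => `|(f x ^+ 2)%:E|%E)); first exact: fi.
by apply/funext => x /=; rewrite powR_mulrn// normrX.
Qed.

Lemma dotpC f g : dot f g = dot g f.
Proof. by apply: eq_Rintegral => x _; rewrite mulrC. Qed.

Lemma dotp_linearl c f g h : f \in L2 -> g \in L2 -> h \in L2 ->
  dot (c *: f + g) h = c * dot f h + dot g h.
Proof.
move=> lf lg lh; rewrite /dotp -RintegralZl//; last exact: L2_integrableM.
rewrite -RintegralD//; last 2 first.
- by have := L2_integrableM (L2_scale c lf) lh; apply: eq_integrable => // x _ /=;
     rewrite -mulrA.
- exact: L2_integrableM.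
by apply: eq_Rintegral => x _; rewrite [LHS](_ : _ = (c * f x + g x) * h x)//; ring.
Qed.

Lemma dotpBl f g h : f \in L2 -> g \in L2 -> h \in L2 ->
  dot (f - g) h = dot f h - dot g h.
Proof.
by move=> *; rewrite addrC -scaleN1r dotp_linearl// mulN1r addrC.
Qed.

Lemma dotpZl c f g : f \in L2 -> g \in L2 -> dot (c *: f) g = c * dot f g.
Proof.
move=> lf lg; rewrite -[X in dot X]addr0 dotp_linearl// ?L2_0//.
rewrite [X in _ + X](_ : _ = 0) ?addr0// /dotp.
by under eq_Rintegral do rewrite mul0r; rewrite Rintegral_cst// mul0r.
Qed.

Lemma dotp_ge0 f : 0 <= dot f f.
Proof. by apply: Rintegral_ge0 => x _; rewrite -expr2 sqr_ge0. Qed.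

Lemma dotp_CS f g : f \in L2 -> g \in L2 -> dot f g ^+ 2 <= dot f f * dot g g.
Proof.
move=> lf lg; apply: discriminant_le => t.
have := dotp_ge0 (t *: g + f).
have lh : t *: g + f \in L2 by exact: L2_linear.
rewrite dotp_linearl// (dotpC g) (dotpC f) !dotp_linearl// (dotpC g f).
by rewrite (_ : _ + _ = dot f f + 2 * t * dot f g + t ^+ 2 * dot g g)//; ring.
Qed.

(** The parallelogram law without its nonnegative term [dot (f - g) (f - g)]. It replaces the
    triangle inequality throughout and avoids square roots. *)
Lemma dotpD_le f g : f \in L2 -> g \in L2 ->
  dot (f + g) (f + g) <= 2 * dot f f + 2 * dot g g.
Proof.
move=> lf lg; rewrite -[f]scale1r.
have lh : 1 *: f + g \in L2 by exact: L2_linear.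
rewrite dotp_linearl// (dotpC _ (_ + _)) (dotpC g) !dotp_linearl// (dotpC g f).
have := dotp_ge0 (f - g).
rewrite dotpBl// ?L2_sub// (dotpC _ (_ - _)) (dotpC g) !dotpBl// (dotpC g f).
rewrite scale1r; lra.
Qed.

Lemma Lnorm2E f : f \in L2 ->
  ('N[mu]_2%:E[EFin \o f])%E = (Num.sqrt (dot f f))%:E.
Proof.
move=> lf; rewrite unlock /dotp.
have -> : (\int[mu]_x (`|(EFin \o f) x| `^ 2)%E)%E = (dot f f)%:E.
  rewrite /dotp /Rintegral fineK; last exact/integrable_fin_num/L2_integrableM.
  by apply: eq_integral => x _ /=; rewrite powR_mulrn// real_normK ?num_real// expr2.
by rewrite -powR12_sqrt ?dotp_ge0// poweR_EFin.
Qed.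

End L2.

Section L2_complete.
Context d (T : measurableType d) (R : realType).
Variable mu : {measure set T -> \bar R}.
Hypothesis muT : (mu setT < +oo)%E.
Local Notation L2 := (Lfun mu 2%:E).
Local Notation dot := (dotp mu).
Implicit Types f g h : T -> R.

Lemma finite_measure_integrable_cstr (c : R) :
  mu.-integrable setT (EFin \o (fun=> c)).
Proof.
apply: measurable_bounded_integrable => //.
by exists `|c|; split; [exact: num_real|move=> M cM x _ /=; exact: ltW].
Qed.

Lemma L2_normr_integrable f : f \in L2 ->
  mu.-integrable setT (EFin \o (fun x => `|f x|)).
Proof.
move=> lf; have l1 : cst 1 \in L2.
  by apply: L2_sqr => //; exact: (finite_measure_integrable_cstr (1 ^+ 2)).
have := L2_integrableM lf l1.
rewrite (_ : EFin \o (fun x => f x * cst 1 x) = EFin \o f); last first.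
  by apply/funext => x /=; rewrite mulr1.
exact: integrable_norm.
Qed.

(* AM-GM: [|f| <= q + f ^ 2 / q] *)
Lemma L2_integral_normr_le f q : f \in L2 -> 0 < q ->
  (\int[mu]_x `|f x|%:E <= (q * fine (mu setT) + q^-1 * dot f f)%:E)%E.
Proof.
move=> lf q0.
have i2 : mu.-integrable setT (EFin \o (fun x => q^-1 * (f x * f x))).
  have := L2_integrableM (L2_scale q^-1 lf) lf.
  by apply: eq_integrable => // x _ /=; rewrite -mulrA.
have i1 : mu.-integrable setT (EFin \o (fun=> q : R)).
  exact: finite_measure_integrable_cstr.
rewrite -[leLHS]fineK; last first.
  exact: (integrable_fin_num measurableT (L2_normr_integrable lf)).
rewrite lee_fin -[X in _ + X]RintegralZl//; last exact: L2_integrableM.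
rewrite -Rintegral_cst// -RintegralD//.
apply: le_Rintegral => //.
- exact: L2_normr_integrable.
- by have := integrableD measurableT i1 i2.
move=> x _.
have -> : f x * f x = `|f x| ^+ 2 by rewrite real_normK ?num_real// expr2.
rewrite -(ler_pM2l q0) mulrDr mulrA mulfV ?mul1r ?gt_eqF//.
by have := sqr_ge0 (q - `|f x|); rewrite expr2 => ?; have := sqr_ge0 (`|f x|); nra.
Qed.

Lemma ereal_limn_einf_le (u : (\bar R)^nat) c :
  (forall n, u n <= c)%E -> (limn_einf u <= c)%E.
Proof.
move=> uc; rewrite limn_einf_lim; apply: lime_le; first exact: is_cvg_einfs.
apply: nearW => n; apply: le_trans (uc n).
by apply: ereal_inf_lbound; exists n => /=.
Qed.

(** Riesz-Fischer. The rate makes the increments summable in L^1, hence the sequence converges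
    almost everywhere; Fatou's lemma then transfers the Cauchy estimate to the limit with the same
    [C]. *)
Lemma L2_complete (f : nat -> T -> R) (C : R) : (forall k, f k \in L2) ->
  (forall k l, (k <= l)%N -> dot (f k - f l) (f k - f l) <= C * 4^-1 ^+ k) ->
  exists2 g, g \in L2 & forall k, dot (f k - g) (f k - g) <= C * 4^-1 ^+ k.
Proof.
move=> lf fC.
have mf n : measurable_fun setT (f n) by exact: L2_measurable.
pose e n x : R := `|f n.+1 x - f n x|.
have e0 n x : 0 <= e n x by exact: normr_ge0.
have me n : measurable_fun setT (fun x => (e n x)%:E).
  by apply/measurable_EFinP; apply: measurableT_comp => //; exact: measurable_funB.
(* Taking [q = 2^-n] in the L^1 estimate balances its two terms: [2^-n * mu setT + 2^n * C * 4^-n =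
   M / 2^n]. *)
pose M := fine (mu setT) + C.
have intd n : (\int[mu]_x (e n x)%:E <= (M / 2 ^+ n)%:E)%E.
  have q0 : 0 < (2 ^+ n)^-1 :> R by rewrite invr_gt0 exprn_gt0.
  apply: (le_trans (L2_integral_normr_le (L2_sub (lf n.+1) (lf n)) q0)).
  rewrite lee_fin invrK /M mulrDl mulrC lerD2l.
  have -> : dot (f n.+1 - f n) (f n.+1 - f n) = dot (f n - f n.+1) (f n - f n.+1).
    by apply: eq_Rintegral => x _; rewrite -[LHS]mulrNN; congr (_ * _); exact: opprB.
  have := fC n n.+1 (leqnSn n).
  rewrite -(ler_pM2l (exprn_gt0 n (ltr0n R 2))) => /le_trans; apply.
  have -> : 4 = 2 * 2 :> R by ring.
  by rewrite exprVn exprMn invfM mulrCA mulVKf// expf_neq0.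
pose S x : \bar R := (\sum_(n <oo) (e n x)%:E)%E.
have S0 x : (0 <= S x)%E by apply: nneseries_ge0 => n _ _; rewrite lee_fin.
have mS : measurable_fun setT S.
  by apply: ge0_emeasurable_sum => // n x _; rewrite lee_fin.
have Sint : mu.-integrable setT S.
  apply/integrableP; split => //.
  under eq_integral => x _ do rewrite gee0_abs//.
  rewrite integral_nneseries//; last by move=> n x _; rewrite lee_fin.
  apply: (@le_lt_trans _ _ (\sum_(n <oo) (M / 2 ^+ n)%:E)%E).
    apply: lee_nneseries => // n _ _; apply: integral_ge0 => x _; rewrite lee_fin.
    exact: e0.
  (* The terms of this series carry [2 ^ (k + 1)], hence the compensating factor in [2 * M]. *)
  have H := @cvg_geometric_eseries_half R (2 * M) 0.
  rewrite [ltLHS](_ : _ = (2 * M / 2 ^+ 0)%:E) ?ltry// -(cvg_lim _ H)//.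
  congr (limn _); apply/funext => m; apply: eq_bigr => k _.
  by rewrite addn1 natrX exprS -mulf_div divff// mul1r.
(* An upper limit is defined at every point, which gives measurability at once; it is the limit
   almost everywhere, and its values elsewhere do not matter. *)
pose g x : R := fine (limn_esup (fun n => (f n x)%:E)).
have mg : measurable_fun setT g.
  apply: measurableT_comp => //; apply: measurable_fun_limn_esup => n.
  exact/measurable_EFinP.
have aeg : {ae mu, forall x, (f n x @[n --> \oo] --> g x)}.
  (* Where [S] is finite, the telescoping series of [f n x] converges absolutely. *)
  have := integrable_ae measurableT Sint; apply: filterS => x /(_ I) Sx.
  have : cvgn (series (e^~ x)).
    by apply: nnseries_is_cvg => //; move: Sx; rewrite ge0_fin_numE.
  move=> /(@normed_cvg R R (telescope (f^~ x))) cs.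
  have fx : cvgn (f^~ x).
    rewrite (_ : f^~ x = (fun n => f 0%N x + series (telescope (f^~ x)) n)).
      by apply: is_cvgD => //; exact: is_cvg_cst.
    by apply/funext => n; exact: (eq_sum_telescope (f^~ x)).
  rewrite /g is_cvg_limn_esupE; last first.
    apply/cvg_ex; exists (limn (f^~ x))%:E.
    by apply: cvg_EFin; [exact: nearW|exact: fx].
  by rewrite EFin_lim.
have fg k : (\int[mu]_x ((f k x - g x) ^+ 2)%:E <= (C * 4^-1 ^+ k)%:E)%E.
  (* The shift [k + l] makes the Cauchy estimate of index [k] available for every [l], so it bounds
     the lower limit in Fatou's lemma. *)
  pose F l x : \bar R := ((f k x - f (k + l)%N x) ^+ 2)%:E.
  have mF l : measurable_fun setT (F l).
    by apply/measurable_EFinP; apply: measurable_funX; exact: measurable_funB.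
  have F0 l x : (0 <= F l x)%E by rewrite lee_fin sqr_ge0.
  have := fatou mu measurableT mF (fun l x _ => F0 l x).
  move=> /le_trans => /(_ (C * 4^-1 ^+ k)%:E) H.
  rewrite (@ge0_ae_eq_integral _ _ _ mu setT _ (fun x => limn_einf (F^~ x)))//.
  - apply: H; apply: ereal_limn_einf_le => l.
    have := fC k (k + l)%N (leq_addr _ _).
    rewrite -lee_fin; apply: le_trans.
    rewrite /dotp /Rintegral fineK; last first.
      by apply/integrable_fin_num => //; apply: L2_integrableM; exact: L2_sub.
    by rewrite le_eqVlt; apply/predU1P; left; apply: eq_integral => x _; rewrite /F expr2.
  - apply/measurable_EFinP; apply: measurable_funX; exact: measurable_funB.
  - rewrite /limn_einf; apply: measurableT_comp => //.
    apply: (measurable_fun_limn_esup (f := fun n x => - F n x)%E) => n.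
    exact: measurableT_comp.
  - by move=> x _; rewrite lee_fin sqr_ge0.
  - move=> x _; rewrite limn_einf_lim; apply: lime_ge; first exact: is_cvg_einfs.
    by apply: nearW => n; apply: le_ereal_inf_tmp => _ [m _ <-].
  - move: aeg; apply: filterS => x fx _.
    apply/esym; apply: (cvg_limn_einf_sup _).1.
    apply: cvg_EFin; first exact: nearW.
    have fkx : f k x - f (k + l)%N x @[l --> \oo] --> f k x - g x.
      apply: cvgB; first exact: cvg_cst.
      by under eq_cvg do rewrite addnC; move: fx; rewrite -(cvg_shiftn k).
    by rewrite expr2; under eq_cvg do rewrite /= expr2; exact: cvgM.
have lfg k : f k - g \in L2.
  apply: L2_sqr; first exact: measurable_funB.
  apply/integrableP; split.
    by apply/measurable_EFinP; apply: measurable_funX; exact: measurable_funB.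
  under eq_integral => x _ do rewrite gee0_abs ?lee_fin ?sqr_ge0//.
  by apply: le_lt_trans (fg k) _; rewrite ltry.
(* Fatou's bound only puts the differences in L^2; [g] follows as [f 0 - (f 0 - g)]. *)
exists g; first by have := L2_sub (lf 0%N) (lfg 0%N); rewrite opprB addrC subrK.
move=> k; rewrite -lee_fin; apply: le_trans (fg k).
rewrite /dotp /Rintegral fineK; last first.
  by apply/integrable_fin_num => //; apply: L2_integrableM.
by rewrite le_eqVlt; apply/predU1P; left; apply: eq_integral => x _; rewrite expr2.
Qed.

End L2_complete.

(** * Integration on (0, pi) *)

Lemma bounded_mul_L2 d (T : measurableType d) (R : realType)
    (mu : {measure set T -> \bar R}) (b f : T -> R) (M : R) :
  measurable_fun setT b -> (forall x, `|b x| <= M) -> f \in Lfun mu 2%:E ->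
  (fun x => b x * f x) \in Lfun mu 2%:E.
Proof.
move=> mb bM lf; have mf := L2_measurable lf.
have M0 x : 0 <= M := le_trans (normr_ge0 _) (bM x).
apply: L2_sqr; first exact: measurable_funM.
apply: le_integrable (L2_integrableM (L2_scale (M ^+ 2) lf) lf) => //.
  by apply/measurable_EFinP; apply: measurable_funX; exact: measurable_funM.
move=> x _ /=; rewrite lee_fin exprMn normrM.
rewrite [leRHS](_ : _ = M ^+ 2 * `|f x ^+ 2|); last first.
  rewrite [X in `|X|](_ : _ = M ^+ 2 * f x ^+ 2).
    by rewrite normrM ger0_norm ?sqr_ge0.
  by rewrite expr2 [in RHS]expr2 mulrA.
by rewrite normrX ler_wpM2r// lerXn2r// nnegrE (M0 x).
Qed.

Section mu0pi.
Context {R : realType}.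
Local Notation mu := (mu0pi R).
Local Notation leb := (@lebesgue_measure R).
Local Notation L2 := (Lfun (mu0pi R) 2%:E).
Local Notation dot := (dotp (mu0pi R)).
Implicit Types f g : R -> R.

Lemma mu0pi_setT : mu setT = (pi : R)%:E.
Proof.
rewrite /mu0pi /= /mrestr setTI lebesgue_measure_itv/= lte_fin pi_gt0.
by rewrite oppr0 adde0.
Qed.

Lemma mu0pi_finite : (mu setT < +oo)%E.
Proof. by rewrite mu0pi_setT ltry. Qed.

Lemma continuous_measurable f : continuous f ->
  measurable_fun [set: measurableTypeR R] f.
Proof. exact: continuous_measurable_fun. Qed.

Lemma ge0_integral_mu0pi (f : measurableTypeR R -> \bar R) : measurable_fun setT f ->
  (forall x, 0 <= f x)%E ->
  (\int[mu]_x f x = \int[leb]_(x in `]0%R, pi[) f x)%E.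
Proof.
move=> mf f0.
have mI : measurable (~` `]0%R, pi[%classic : set (measurableTypeR R)).
  by apply: measurableC; exact: measurable_itv.
rewrite (ge0_negligible_integral mI)//; last first.
  by rewrite /mu0pi /= /mrestr setICl measure0.
rewrite setTD setCK; apply: eq_measure_integral => A mA /setIidPl AI.
by rewrite /mu0pi /= /mrestr AI.
Qed.

Lemma continuous_integrable_mu0pi f : continuous f ->
  mu.-integrable setT (EFin \o f).
Proof.
move=> cf; apply/integrableP; split.
  by apply/measurable_EFinP; exact: continuous_measurable.
rewrite ge0_integral_mu0pi//; last first.
  by do 2 apply: measurableT_comp => //; exact: continuous_measurable.
have ic : leb.-integrable `[0, pi] (EFin \o f).
  apply: continuous_compact_integrable; first exact: segment_compact.
  exact: continuous_subspaceT.
have : leb.-integrable `]0, pi[ (EFin \o f).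
  by apply: integrableS ic => //; exact: subset_itv_oo_cc.
by move/integrableP => [].
Qed.

(** The complement of []0, pi[] is [mu0pi]-null and the endpoints are Lebesgue-null. The closed
    segment is the domain on which the fundamental theorem of calculus is applied. *)
Lemma integral_mu0pi f : continuous f ->
  \int[mu]_x f x = \int[leb]_(x in `[0, pi]) f x.
Proof.
move=> cf.
have mI : measurable (~` `]0%R, pi[%classic : set (measurableTypeR R)).
  by apply: measurableC; exact: measurable_itv.
rewrite /Rintegral (negligible_integral mI)//; last 2 first.
- exact: continuous_integrable_mu0pi.
- by rewrite /mu0pi /= /mrestr setICl measure0.
rewrite setTD setCK; congr fine.
rewrite (@eq_measure_integral _ _ _ _ leb)//; last first.
  by move=> A mA /setIidPl AI; rewrite /mu0pi /= /mrestr AI.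
rewrite [RHS]integral_itv_bndoo//; apply/measurable_EFinP; apply: measurable_funTS;
  exact: continuous_measurable.
Qed.

Lemma continuous_L2 f : continuous f -> f \in L2.
Proof.
move=> cf; apply: L2_sqr; first exact: continuous_measurable.
rewrite (_ : (fun x => f x ^+ 2) = f \* f); last by apply/funext => x; rewrite /= expr2.
by apply: continuous_integrable_mu0pi => x; apply: continuousM; exact: cf.
Qed.

(** The only form in which the fundamental theorem of calculus is used: orthogonality of cosines and
    integration by parts both reduce to a primitive with equal endpoint values. *)
Lemma integral_derive_eq0 (G g : R -> R) : (forall x : R, is_derive x (1 : R) G (g x)) ->
  continuous g -> G 0 = G pi -> \int[mu]_x g x = 0.
Proof.
move=> dG cg G0; rewrite integral_mu0pi// /Rintegral.
have cG : continuous G.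
  by move=> x; apply/differentiable_continuous/derivable1_diffP; exact: ex_derive.
rewrite (@continuous_FTC2 _ g G)//.
- by rewrite G0 subee.
- exact: pi_gt0.
- exact: continuous_subspaceT.
- split.
  + by move=> x _; exact: ex_derive.
  + by apply: cvg_at_right_filter; exact: cG.
  + by apply: cvg_at_left_filter; exact: cG.
- by move=> x _; rewrite derive1E derive_val.
Qed.

End mu0pi.

(** * Bessel inequality for the cosines *)

(** By induction on [N], the projections on [e 0], ..., [e (N-1)] are removed from [f]. The
    remainder [r] keeps the coefficients of [f] from index [N] on, and its nonnegative squared norm
    is the claimed difference divided by [c]. *)
Lemma bessel_inequality d (T : measurableType d) (R : realType)
    (mu : {measure set T -> \bar R}) (e : nat -> T -> R) (c : R) (f : T -> R) N :
  0 < c -> (forall n, e n \in Lfun mu 2%:E) ->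
  (forall n m, dotp mu (e n) (e m) = if n == m then c else 0) ->
  f \in Lfun mu 2%:E ->
  \sum_(0 <= n < N) dotp mu f (e n) ^+ 2 <= c * dotp mu f f.
Proof.
move=> c0 le ee lf.
suff [r [lr rr _]] : exists r, [/\ r \in Lfun mu 2%:E,
    dotp mu r r = dotp mu f f - c^-1 * \sum_(0 <= n < N) dotp mu f (e n) ^+ 2
    & forall m, (N <= m)%N -> dotp mu r (e m) = dotp mu f (e m)].
  by have := dotp_ge0 mu r; rewrite rr subr_ge0 ler_pdivrMl.
elim: N => [|N [r [lr rr re]]].
  by exists f; rewrite big_geq// mulr0 subr0.
pose a := dotp mu f (e N) / c.
have reN : dotp mu r (e N) = a * c by rewrite re// /a divfK// gt_eqF.
exists (- a *: e N + r).
have lr' : - a *: e N + r \in Lfun mu 2%:E by exact: L2_linear.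
split => //.
  rewrite dotp_linearl// !(dotpC mu _ (_ *: _ + _)) !dotp_linearl// (dotpC mu (e N) r).
  rewrite reN ee eqxx rr big_nat_recr//= (_ : dotp mu f (e N) = a * c); last first.
    by rewrite /a divfK// gt_eqF.
  by field; rewrite gt_eqF.
move=> m Nm; rewrite dotp_linearl// ee ltn_eqF// mulr0 add0r re//.
exact: ltnW.
Qed.

Section trigo_mu0pi.
Context {R : realType}.
Local Notation mu := (mu0pi R).
Local Notation dot := (dotp (mu0pi R)).

Lemma is_derive_cosM (c x : R) :
  is_derive x (1 : R) (fun y => cos (c * y)) (- c * sin (c * x)).
Proof.
have H : is_derive x (1 : R) (fun y => c * y) c.
  by apply: is_derive_eq; rewrite /GRing.scale /= mulr1.
have := is_derive1_comp (is_derive_cos (c * x)) H.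
by rewrite /GRing.scale /= mulNr mulrC mulNr.
Qed.

Lemma is_derive_sinM (c x : R) :
  is_derive x (1 : R) (fun y => sin (c * y)) (c * cos (c * x)).
Proof.
have H : is_derive x (1 : R) (fun y => c * y) c.
  by apply: is_derive_eq; rewrite /GRing.scale /= mulr1.
have := is_derive1_comp (is_derive_sin (c * x)) H.
by rewrite /GRing.scale /= mulrC.
Qed.

Lemma is_derive_continuous (f f' : R -> R) :
  (forall x : R, is_derive x (1 : R) f (f' x)) -> continuous f.
Proof.
move=> df x; apply/differentiable_continuous/derivable1_diffP.
by have := df x => dfx; exact: ex_derive.
Qed.

Lemma continuous_cosM (c : R) : continuous (fun x : R => cos (c * x)).
Proof. exact: is_derive_continuous (is_derive_cosM c). Qed.

Lemma continuous_sinM (c : R) : continuous (fun x : R => sin (c * x)).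
Proof. exact: is_derive_continuous (is_derive_sinM c). Qed.

Lemma sin_natpi n : sin (n%:R * pi) = 0 :> R.
Proof.
elim: n => [|n IH]; first by rewrite mul0r sin0.
by rewrite -natr1 mulrDl mul1r sinDpi IH oppr0.
Qed.

Lemma integral_cosM (c : R) : c != 0 -> sin (c * pi) = 0 ->
  \int[mu]_x cos (c * x) = 0.
Proof.
move=> c0 sc.
apply: (@integral_derive_eq0 _ (fun x => c^-1 * sin (c * x))).
- move=> x; have H := is_derive_sinM c x; apply: is_derive_eq.
  by rewrite /GRing.scale /= mulKf.
- exact: continuous_cosM.
- by rewrite mulr0 sin0 sc.
Qed.

(** Product-to-sum formula. The shift [n.+1] leaves out the constant function, whose squared norm is
    [pi] instead of [pi / 2]. *)
Lemma dotp_cos n m :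
  dot (fun x : R => cos (n.+1%:R * x)) (fun x => cos (m.+1%:R * x)) =
  if n == m then pi / 2 else 0.
Proof.
have L (c : R) : mu.-integrable setT (EFin \o (fun x => cos (c * x))).
  by apply: continuous_integrable_mu0pi; exact: continuous_cosM.
have -> : dot (fun x : R => cos (n.+1%:R * x)) (fun x => cos (m.+1%:R * x)) =
    2^-1 * (\int[mu]_x cos ((n.+1%:R - m.+1%:R) * x)
            + \int[mu]_x cos ((n.+1%:R + m.+1%:R) * x)).
  rewrite -RintegralD// -RintegralZl//; last first.
    by have := integrableD measurableT (L (n.+1%:R - m.+1%:R))
      (L (n.+1%:R + m.+1%:R)).
  apply: eq_Rintegral => x _; rewrite !mulrDl mulNr cosB cosD.
  by field.
rewrite [X in _ * (_ + X)]integral_cosM ?addr0; last 2 first.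
- by rewrite gt_eqF// addr_gt0.
- by rewrite -natrD sin_natpi.
case: eqVneq => [->|nm].
  rewrite subrr; under eq_Rintegral do rewrite mul0r cos0.
  by rewrite Rintegral_cst//= mu0pi_setT/= mul1r mulrC.
rewrite integral_cosM ?mulr0//.
  by rewrite subr_eq0 eqr_nat eqSS.
by rewrite mulrBl sinB !sin_natpi mul0r mulr0 subrr.
Qed.

Lemma cos_bessel (f : R -> R) N : f \in Lfun mu 2%:E ->
  \sum_(0 <= n < N) dot f (fun x => cos (n.+1%:R * x)) ^+ 2 <= pi / 2 * dot f f.
Proof.
move=> lf; apply: (@bessel_inequality _ _ _ mu (fun n x => cos (n.+1%:R * x))) => //.
- by rewrite divr_gt0// pi_gt0.
- by move=> n; apply: continuous_L2; exact: continuous_cosM.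
- exact: dotp_cos.
Qed.

Lemma integration_by_parts0 (F G F' G' : R -> R) :
  (forall x : R, is_derive x (1 : R) F (F' x)) ->
  (forall x : R, is_derive x (1 : R) G (G' x)) ->
  continuous F' -> continuous G' -> F 0 = 0 -> F pi = 0 ->
  dot F G' + dot F' G = 0.
Proof.
move=> dF dG cF' cG' F0 Fpi.
have cF := is_derive_continuous dF; have cG := is_derive_continuous dG.
rewrite /dotp -RintegralD//; last 2 first.
- by apply: L2_integrableM; exact: continuous_L2.
- by apply: L2_integrableM; exact: continuous_L2.
apply: (@integral_derive_eq0 _ (fun x => F x * G x)).
- move=> x; have := dF x => dFx; have := dG x => dGx; apply: is_derive_eq.
  by rewrite /GRing.scale /=; ring.
- by move=> x; apply: cvgD; apply: cvgM;
    [exact: cF|exact: cG'|exact: cF'|exact: cG].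
- by rewrite F0 Fpi !mul0r.
Qed.

End trigo_mu0pi.

(** * Test functions *)

Section test_functions.
Context {R : realType}.
Local Notation mu := (mu0pi R).
Local Notation L2 := (Lfun (mu0pi R) 2%:E).
Local Notation dot := (dotp (mu0pi R)).
Implicit Types (phi psi u v : R -> R).

Lemma test_function_is_derive phi (x : R) : test_function phi ->
  is_derive x (1 : R) phi (derive1 phi x).
Proof.
by move=> [+ _ _] => /(_ 0%N x) dphi; rewrite derive1E; exact: DeriveDef.
Qed.

Lemma test_function_continuous phi : test_function phi -> continuous phi.
Proof.
by move=> tphi; apply: is_derive_continuous => x; exact: test_function_is_derive.
Qed.

Lemma test_function_continuous_derive phi :
  test_function phi -> continuous (derive1 phi).
Proof.
by move=> [+ _ _] => /(_ 1%N) dphi x;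
  apply/differentiable_continuous/derivable1_diffP; exact: dphi.
Qed.

Lemma test_function_out phi x : test_function phi -> ~ (0 < x < pi) -> phi x = 0.
Proof.
move=> [_ _ sub] nx; apply: contrapT => /eqP phix; apply: nx.
by have := sub x; rewrite /= in_itv /=; apply; exact: subset_closure.
Qed.

Lemma test_function_0 phi : test_function phi -> phi 0 = 0.
Proof. by move=> tphi; apply: test_function_out => //; rewrite ltxx. Qed.

Lemma test_function_pi phi : test_function phi -> phi pi = 0.
Proof. by move=> tphi; apply: test_function_out => //; rewrite ltxx andbF. Qed.

Lemma test_function_L2 phi : test_function phi -> phi \in L2.
Proof. by move=> /test_function_continuous/continuous_L2. Qed.

Lemma test_function_derive_L2 phi : test_function phi -> derive1 phi \in L2.
Proof. by move=> /test_function_continuous_derive/continuous_L2. Qed.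

Lemma derive1_linear (c : R) phi psi :
  (forall x : R, derivable phi x 1) -> (forall x : R, derivable psi x 1) ->
  derive1 (c *: phi + psi) = c *: derive1 phi + derive1 psi.
Proof.
move=> dphi dpsi; apply/funext => x.
rewrite derive1E deriveD//; last exact: derivableZ.
by rewrite deriveZ// -!derive1E.
Qed.

Lemma test_function_linear (c : R) phi psi :
  test_function phi -> test_function psi -> test_function (c *: phi + psi).
Proof.
move=> [dphi kphi sphi] [dpsi kpsi spsi].
have dn n : derive1n n (c *: phi + psi) = c *: derive1n n phi + derive1n n psi.
  elim: n => // n IH; rewrite !derive1nS IH.
  by apply: derive1_linear => x; [exact: dphi|exact: dpsi].
have sub : closure [set x | (c *: phi + psi) x != 0] `<=`
    closure [set x | phi x != 0] `|` closure [set x | psi x != 0].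
  rewrite -closureU; apply: closure_subset => x /=.
  move=> nz; have [p0|p0] := eqVneq (phi x) 0; [right|by left].
  apply: contra_neq nz => q0.
  by rewrite [LHS](_ : _ = c * phi x + psi x)// p0 q0 mulr0 addr0.
split.
- move=> n x; rewrite dn; apply: derivableD; first exact: derivableZ.
  exact: dpsi.
- apply: subclosed_compact sub; first exact: closed_closure.
  exact: compactU.
- by apply: subset_trans sub _; rewrite subUset.
Qed.

Lemma test_function_integral_derive phi (g g' : R -> R) : test_function phi ->
  (forall x : R, is_derive x (1 : R) g (g' x)) -> continuous g' ->
  dot phi g' + dot (derive1 phi) g = 0.
Proof.
move=> tphi dg cg; apply: integration_by_parts0 => //.
- by move=> x; exact: test_function_is_derive.
- exact: test_function_continuous_derive.
- exact: test_function_0.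
- exact: test_function_pi.
Qed.

(* [(x phi ^ 2)' = phi ^ 2 + 2 x phi phi'] integrates to [0]. *)
Lemma test_function_poincare phi : test_function phi ->
  dot phi phi <= 4 * pi ^+ 2 * dot (derive1 phi) (derive1 phi).
Proof.
move=> tphi; have cphi := test_function_continuous tphi.
have lphi := test_function_L2 tphi; have ldphi := test_function_derive_L2 tphi.
have cx : continuous (fun x : R => x * phi x).
  by move=> x; apply: cvgM; [exact: cvg_id|exact: cphi].
have cdx : continuous (fun x : R => x * derive1 phi x).
  by move=> x; apply: cvgM; [exact: cvg_id|exact: test_function_continuous_derive].
have := @test_function_integral_derive phi (fun x => x * phi x)
  (fun x => phi x + x * derive1 phi x) tphi.
have H1 (x : R) : is_derive x (1 : R) (fun x => x * phi x) (phi x + x * derive1 phi x).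
  have := test_function_is_derive x tphi => ?; apply: is_derive_eq.
  by rewrite /GRing.scale /=; ring.
have H2 : continuous (fun x => phi x + x * derive1 phi x).
  by move=> x; apply: cvgD; [exact: cphi|exact: cdx].
move=> /(_ H1 H2).
have -> : dot phi (fun x => phi x + x * derive1 phi x) =
    dot phi phi + dot (fun x => x * phi x) (derive1 phi).
  rewrite /dotp -RintegralD//.
  - by apply: eq_Rintegral => x _; ring.
  - exact: L2_integrableM.
  - by apply: L2_integrableM => //; exact: continuous_L2.
rewrite (dotpC mu (derive1 phi)).
have := dotp_CS (continuous_L2 cx) ldphi.
have : dot (fun x => x * phi x) (fun x => x * phi x) <= pi ^+ 2 * dot phi phi.
  rewrite /dotp -RintegralZl//; last exact: L2_integrableM.
  apply: le_Rintegral => //.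
  - by apply: L2_integrableM; exact: continuous_L2.
  - have := L2_integrableM (L2_scale (pi ^+ 2) lphi) lphi.
    by apply: eq_integrable => // x _ /=; rewrite -mulrA.
  move=> x _; rewrite (_ : x * phi x * (x * phi x) = x ^+ 2 * (phi x * phi x));
    last by ring.
  (* The comparison is required on the whole line; outside [(0, pi)] it holds because [phi] vanishes
     there. *)
  have [/andP[x0 xpi]|nx] := boolP (0 < x < pi).
    by rewrite ler_wpM2r -?expr2 ?sqr_ge0// lerXn2r ?nnegrE ?ltW// ?pi_gt0.
  by rewrite (test_function_out tphi (negP nx)) !mulr0.
have := dotp_ge0 mu phi; have := dotp_ge0 mu (derive1 phi).
set A := dot phi phi; set B := dot (derive1 phi) (derive1 phi).
set X := dot (fun x => x * phi x) (fun x => x * phi x).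
set Y := dot _ (derive1 phi).
move: A B X Y (pi ^+ 2) (sqr_ge0 (pi : R)) => A B X Y p p0 B0 A0 XA.
rewrite expr2 => YX AY; rewrite leNgt; apply/negP => lt.
have : X * B <= p * A * B by exact: ler_wpM2r.
(* Integration by parts reads [A + 2 Y = 0], so Cauchy-Schwarz [Y^2 <= X B <= p A B] becomes
   [A^2 / 4 <= p A B], whence the factor 4. *)
have YA : Y = - A / 2 by lra.
have A1 : 0 < A by apply: le_lt_trans lt; rewrite !mulr_ge0.
by rewrite YA in YX; nra.
Qed.

(** Trades the extended-real norm of [L2_cvg] for real squared distances, by continuity of the
    square root at 0 and of squaring. *)
Lemma L2_cvgP (f : nat -> R -> R) u : (forall k, f k \in L2) -> u \in L2 ->
  L2_cvg f u <-> dot (f k - u) (f k - u) @[k --> \oo] --> 0.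
Proof.
move=> lf lu; rewrite /L2_cvg.
have -> : (fun k => 'N[mu]_2%:E[EFin \o (f k \- u)%R])%E =
    (fun k => (Num.sqrt (dot (f k - u) (f k - u)))%:E).
  by apply/funext => k; rewrite -Lnorm2E// L2_sub.
split => [/fine_cvgP[_ /=]|] H.
  rewrite -[0](mulr0 0); under eq_cvg do rewrite -[dot _ _]sqr_sqrtr ?dotp_ge0// expr2.
  exact: cvgM.
apply: cvg_EFin; first exact: nearW.
by rewrite /= -sqrtr0; apply: continuous_cvg => //; exact: sqrt_continuous.
Qed.

Definition test_approximable u u' := forall e : R, 0 < e ->
  exists phi, [/\ test_function phi, dot (phi - u) (phi - u) < e
    & dot (derive1 phi - u') (derive1 phi - u') < e].

(** The left-hand side is L^2-continuous in [(u, u')], so its vanishing on test functions extends to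
    the closure. This is how every integration by parts reaches H^1_0. *)
Lemma test_approximable_functional u u' f g : u \in L2 -> u' \in L2 ->
  f \in L2 -> g \in L2 -> test_approximable u u' ->
  (forall phi, test_function phi -> dot phi f + dot (derive1 phi) g = 0) ->
  dot u f + dot u' g = 0.
Proof.
move=> lu lu' lf lg app H.
suff : (dot u f + dot u' g) ^+ 2 <= 0.
  by rewrite real_exprn_even_le0 ?num_real//= => /eqP.
apply: (@le0_geometric _ _ (2 * (dot f f + dot g g))) => k.
have q0 : 0 < 4^-1 ^+ k :> R by rewrite exprn_gt0// invr_gt0.
have [phi [tphi ue u'e]] := app _ q0.
have lphi := test_function_L2 tphi; have ldphi := test_function_derive_L2 tphi.
have -> : dot u f + dot u' g = - (dot (phi - u) f + dot (derive1 phi - u') g).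
  by have := H _ tphi; rewrite !dotpBl//; lra.
have := dotp_CS (L2_sub lphi lu) lf; have := dotp_CS (L2_sub ldphi lu') lg.
have := dotp_ge0 mu f; have := dotp_ge0 mu g.
move: (dot (phi - u) f) (dot f f) ue (dot (derive1 phi - u') g) (dot g g) u'e.
move=> F f2 ue G g2 u'e g20 f20 GF FF.
have Uf : dot (phi - u) (phi - u) * f2 <= 4^-1 ^+ k * f2 by rewrite ler_wpM2r// ltW.
have Ug : dot (derive1 phi - u') (derive1 phi - u') * g2 <= 4^-1 ^+ k * g2.
  by rewrite ler_wpM2r// ltW.
by have := sqr_ge0 (F - G); rewrite !expr2 in GF FF *; lra.
Qed.

(** From right to left, the weak derivative identity of [H1] is the limit of integration by parts
    between two test functions, and the approximating sequence comes from choosing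
    [e = 4^-1 ^+ k]. *)
Lemma H10P u u' :
  H10 u u' <-> [/\ u \in L2, u' \in L2 & test_approximable u u'].
Proof.
split => [[[lu lu' _] [phi [tphi phiu phiu']]]|[lu lu' app]].
  split => // e e0.
  have lphi k := test_function_L2 (tphi k).
  have ldphi k := test_function_derive_L2 (tphi k).
  move/(L2_cvgP lphi lu)/cvgrPdist_lt/(_ _ e0) : phiu => [N1 _ H1].
  move/(L2_cvgP ldphi lu')/cvgrPdist_lt/(_ _ e0) : phiu' => [N2 _ H2].
  exists (phi (maxn N1 N2)); split => //.
    have := H1 _ (leq_maxl N1 N2); rewrite /= sub0r normrN.
    by rewrite ger0_norm ?dotp_ge0.
  have := H2 _ (leq_maxr N1 N2); rewrite /= sub0r normrN.
  by rewrite ger0_norm ?dotp_ge0.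
split.
  split => // psi tpsi; apply/eqP; rewrite -addr_eq0; apply/eqP.
  apply: (@test_approximable_functional u u' (derive1 psi) psi) => //.
  - exact: test_function_derive_L2.
  - exact: test_function_L2.
  - move=> phi tphi; apply: test_function_integral_derive => //.
      by move=> x; exact: test_function_is_derive.
    exact: test_function_continuous_derive.
have q0 : 0 < 4^-1 :> R by rewrite invr_gt0.
have [phi Hphi] : {phi : nat -> R -> R & forall k, [/\ test_function (phi k),
    dot (phi k - u) (phi k - u) < 4^-1 ^+ k
    & dot (derive1 (phi k) - u') (derive1 (phi k) - u') < 4^-1 ^+ k]}.
  exists (fun k => projT1 (cid (app _ (exprn_gt0 k q0)))) => k.
  by case: cid.
have cvg4 : (4^-1 : R) ^+ k @[k --> \oo] --> 0.
  by apply: cvg_expr; rewrite gtr0_norm// invf_lt1//; lra.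
have tphi k : test_function (phi k) by have [] := Hphi k.
exists phi; split => //.
- apply/L2_cvgP => //; first by move=> k; exact: test_function_L2.
  apply: (@squeeze_cvgr _ _ _ _ (cst 0) _ _ _ _ (cvg_cst _) cvg4).
  by apply: nearW => k; rewrite dotp_ge0 ltW//; have [] := Hphi k.
- apply/L2_cvgP => //; first by move=> k; exact: test_function_derive_L2.
  apply: (@squeeze_cvgr _ _ _ _ (cst 0) _ _ _ _ (cvg_cst _) cvg4).
  by apply: nearW => k; rewrite dotp_ge0 ltW//; have [] := Hphi k.
Qed.

End test_functions.

(** * The space H^1_0 *)

Section H10_theory.
Context {R : realType}.
Local Notation mu := (mu0pi R).
Local Notation L2 := (Lfun (mu0pi R) 2%:E).
Local Notation dot := (dotp (mu0pi R)).
Implicit Types (phi psi u v : R -> R).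

Lemma H10_linear (c : R) u u' v v' :
  H10 u u' -> H10 v v' -> H10 (c *: u + v) (c *: u' + v').
Proof.
move=> /H10P[lu lu' uapp] /H10P[lv lv' vapp]; apply/H10P.
split; [exact: L2_linear|exact: L2_linear|move=> e e0].
(* By [dotpD_le], errors below [d] on [u] and [v] give an error below [2 c^2 d + 2 d] on the
   combination; this is [e] for [d = e / (2 * (c ^+ 2 + 1))]. *)
have k0 : 0 < 2 * (c ^+ 2 + 1) by rewrite mulr_gt0// ltr_wpDl// sqr_ge0.
have d0 : 0 < e / (2 * (c ^+ 2 + 1)) by rewrite divr_gt0.
have [phi [tphi phiu phiu']] := uapp _ d0.
have [psi [tpsi psiv psiv']] := vapp _ d0.
have [lphi ldphi] := (test_function_L2 tphi, test_function_derive_L2 tphi).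
have [lpsi ldpsi] := (test_function_L2 tpsi, test_function_derive_L2 tpsi).
have key f g f1 g1 : f \in L2 -> g \in L2 -> f1 \in L2 -> g1 \in L2 ->
    dot (f1 - f) (f1 - f) < e / (2 * (c ^+ 2 + 1)) ->
    dot (g1 - g) (g1 - g) < e / (2 * (c ^+ 2 + 1)) ->
    dot ((c *: f1 + g1) - (c *: f + g)) ((c *: f1 + g1) - (c *: f + g)) < e.
  move=> lf lg lf1 lg1; rewrite !ltr_pdivlMr// => ff gg.
  have -> : (c *: f1 + g1) - (c *: f + g) = c *: (f1 - f) + (g1 - g).
    by rewrite scalerBr opprD addrACA.
  have lff := L2_sub lf1 lf.
  apply: le_lt_trans (dotpD_le (L2_scale c lff) (L2_sub lg1 lg)) _.
  rewrite dotpZl ?L2_scale// dotpC dotpZl// -(ltr_pM2r k0) [c * (c * _)]mulrA.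
  move: (dot _ _) (dot _ _) ff gg => B A AA BB.
  have := sqr_ge0 c; rewrite expr2 in AA BB *; move: (c * c) AA BB => c2 AA BB c20.
  have : 2 * c2 * (A * (2 * (c2 + 1))) <= 2 * c2 * e.
    by apply: ler_wpM2l; [lra|exact: ltW].
  lra.
exists (c *: phi + psi); split.
- exact: test_function_linear.
- exact: key.
- rewrite derive1_linear; first exact: key.
    by case: tphi => /(_ 0%N).
  by case: tpsi => /(_ 0%N).
Qed.

Lemma H10_0 : H10 (0 : R -> R) 0.
Proof.
apply/H10P; split => [||e e0]; [exact: L2_0|exact: L2_0|].
have dot0 : dot 0 0 = 0.
  by rewrite -{1}(scale0r (0 : R -> R)) dotpZl ?L2_0// mul0r.
have d0 : derive1 (0 : R -> R) = 0 by apply/funext => x; rewrite derive1_cst.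
exists 0; split; rewrite ?d0 ?subrr ?dot0//.
have s0 : [set x | (0 : R -> R) x != 0] = set0.
  by rewrite -subset0 => x /=; rewrite eqxx.
split; rewrite ?s0 ?closure0//; last exact: compact0.
move=> n x; rewrite (_ : derive1n n 0 = 0); first exact: derivable_cst.
by elim: n => // n IH; rewrite derive1nS IH.
Qed.

(** The constant is four times that for test functions: going from [u] to [phi] and from [phi'] to
    [u'] costs a factor 2 each by [dotpD_le]. The same two steps produce the error constant
    [16 * pi ^+ 2 + 2]. *)
Lemma H10_poincare u u' : H10 u u' -> dot u u <= 16 * pi ^+ 2 * dot u' u'.
Proof.
move=> /H10P[lu lu' app]; rewrite -subr_le0.
apply: (@le0_geometric _ _ (16 * pi ^+ 2 + 2)) => k.
have q0 : 0 < 4^-1 ^+ k :> R by rewrite exprn_gt0// invr_gt0.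
have [phi [tphi phiu phiu']] := app _ q0.
have [lphi ldphi] := (test_function_L2 tphi, test_function_derive_L2 tphi).
have dN f : f \in L2 -> dot (- f) (- f) = dot f f.
  by move=> _; apply: eq_Rintegral => x _; rewrite -[RHS]mulrNN.
have H1 := dotpD_le lphi (L2_sub lu lphi).
have H2 := dotpD_le lu' (L2_sub ldphi lu').
rewrite addrC subrK in H1; rewrite addrC subrK in H2.
rewrite -(dN (u - phi)) ?L2_sub// opprB in H1.
have H3 := test_function_poincare tphi.
have : 4 * pi ^+ 2 * dot (derive1 phi) (derive1 phi) <=
    4 * pi ^+ 2 * (2 * dot u' u' + 2 * 4^-1 ^+ k).
  apply: ler_wpM2l; first by rewrite mulr_ge0// sqr_ge0.
  by apply: (le_trans H2); rewrite lerD2l ler_wpM2l// ltW.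
lra.
Qed.

(** The cosine does not vanish at the endpoints, so the weak derivative identity, which is tested by
    compactly supported functions, does not yield this. The zero boundary values of [u] enter
    through its approximation by test functions. *)
Lemma H10_sine_coef u u' n : H10 u u' ->
  n%:R * sine_coef u n = 2 / pi * dot u' (fun x => cos (n%:R * x)).
Proof.
move=> /H10P[lu lu' app].
have ls : (fun x : R => sin (n%:R * x)) \in L2.
  by apply: continuous_L2; exact: continuous_sinM.
have lc : (fun x : R => cos (n%:R * x)) \in L2.
  by apply: continuous_L2; exact: continuous_cosM.
have cs : continuous (fun x : R => - n%:R * sin (n%:R * x)).
  by move=> x; apply: cvgM; [exact: cvg_cst|exact: continuous_sinM].
have := @test_approximable_functional _ u u' (- n%:R *: (fun x : R => sin (n%:R * x)))
  (fun x => cos (n%:R * x)) lu lu' (L2_scale _ ls) lc app.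
rewrite dotpC dotpZl// (dotpC mu _ u) => H.
rewrite /sine_coef -/(dot u _) mulrCA.
have -> : n%:R * dot u (fun x => sin (n%:R * x)) = dot u' (fun x => cos (n%:R * x)).
  apply/esym/eqP; rewrite -subr_eq0 addrC -mulNr; apply/eqP/H => phi tphi.
  exact: (test_function_integral_derive tphi (is_derive_cosM n%:R)).
by [].
Qed.

Lemma sine_coef_linear (c : R) u v n : u \in L2 -> v \in L2 ->
  sine_coef (c *: u + v) n = c * sine_coef u n + sine_coef v n.
Proof.
move=> lu lv; rewrite /sine_coef -!/(dot _ _) dotp_linearl//; first by ring.
by apply: continuous_L2; exact: continuous_sinM.
Qed.

(** Poincare's inequality makes the functions Cauchy as soon as the derivatives are. The two L^2
    limits form an H^1_0 pair because a test function close to [(u k, u' k)] is close to them. *)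
Lemma H10_complete (u u' : nat -> R -> R) (C : R) : (forall k, H10 (u k) (u' k)) ->
  (forall k l, (k <= l)%N -> dot (u' k - u' l) (u' k - u' l) <= C * 4^-1 ^+ k) ->
  exists w w', H10 w w' /\
    forall k, dot (u' k - w') (u' k - w') <= C * 4^-1 ^+ k.
Proof.
move=> Hu uC.
have lu k : u k \in L2 by have /H10P[] := Hu k.
have lu' k : u' k \in L2 by have /H10P[] := Hu k.
have HB u1 u1' v1 v1' : H10 u1 u1' -> H10 v1 v1' -> H10 (u1 - v1) (u1' - v1').
  by move=> H1 H2; have := H10_linear (-1) H2 H1; rewrite !scaleN1r !(addrC (- _)).
have [w' lw' w'C] := L2_complete mu0pi_finite lu' uC.
have [|w lw wC] := @L2_complete _ _ _ mu mu0pi_finite u (16 * pi ^+ 2 * C) lu.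
  move=> k l kl.
  apply: le_trans (H10_poincare (HB _ _ _ _ (Hu k) (Hu l))) _.
  by rewrite -[leRHS]mulrA; apply: ler_wpM2l; [rewrite mulr_ge0// sqr_ge0|exact: uC].
exists w, w'; split => //; apply/H10P; split => // e e0.
have C0 : 0 <= C.
  by have := uC 0%N 0%N (leqnn _); rewrite expr0 mulr1; apply: le_trans; exact: dotp_ge0.
(* The bound [e / 4] is what [dotpD_le] needs, since it doubles each of two errors. If no [k]
   worked, [e / 4] would lie below a geometric sequence. *)
have [k [k1 k2]] : exists k,
    16 * pi ^+ 2 * C * 4^-1 ^+ k < e / 4 /\ C * 4^-1 ^+ k < e / 4.
  apply: contrapT => nk.
  suff : e / 4 <= 0 by rewrite leNgt divr_gt0.
  apply: (@le0_geometric _ _ (16 * pi ^+ 2 * C + C)) => k.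
  rewrite leNgt; apply/negP => lt; apply: nk; exists k.
  have q0 : 0 <= C * 4^-1 ^+ k by rewrite mulr_ge0// exprn_ge0// invr_ge0.
  have : 0 <= 16 * pi ^+ 2 * C * 4^-1 ^+ k.
    by rewrite -mulrA; apply: mulr_ge0 => //; rewrite mulr_ge0// sqr_ge0.
  by rewrite mulrDl in lt; split; lra.
have /H10P[_ _ /(_ (e / 4))[|phi [tphi p1 p2]]] := Hu k; first by rewrite divr_gt0.
exists phi; split => //.
- rewrite (_ : phi - w = (phi - u k) + (u k - w)); last by rewrite addrA subrK.
  have := dotpD_le (L2_sub (test_function_L2 tphi) (lu k)) (L2_sub (lu k) lw).
  have := wC k; lra.
- rewrite (_ : _ - w' = (derive1 phi - u' k) + (u' k - w')); last by rewrite addrA subrK.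
  have := dotpD_le (L2_sub (test_function_derive_L2 tphi) (lu' k)) (L2_sub (lu' k) lw').
  have := w'C k; lra.
Qed.

End H10_theory.

(** * The nonlocal term and the gap function *)

Lemma coth_ge0 (R : realType) (x : R) : 0 < x -> 0 <= coth x.
Proof.
move=> x0; apply: divr_ge0; first by rewrite addr_ge0 ?expR_ge0.
by rewrite subr_ge0 ler_expR; lra.
Qed.

(** After cross-multiplication the difference of the two sides is [2 (e^(y-x) - e^(x-y))]. *)
Lemma coth_le (R : realType) (x y : R) : 0 < x -> x <= y -> coth y <= coth x.
Proof.
move=> x0 xy; rewrite /coth.
have y0 : 0 < y by exact: lt_le_trans xy.
have H (z : R) : 0 < z -> 0 < expR z - expR (- z).
  by move=> z0; rewrite subr_gt0 ltr_expR; lra.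
rewrite ler_pdivrMr ?H// mulrAC ler_pdivlMr ?H//.
have : expR (- y) * expR x <= expR (- x) * expR y.
  by rewrite -!expRD ler_expR; lra.
by lra.
Qed.

Section coth_form.
Context {R : realType}.
Variable a : R.
Hypothesis a0 : 0 < a.
Local Notation mu := (mu0pi R).
Local Notation L2 := (Lfun (mu0pi R) 2%:E).
Local Notation dot := (dotp (mu0pi R)).
Implicit Types (u v : R -> R).

(** Spelled like the partial sums inside [weak_solution], so that the two are convertible. *)
Definition coth_sum u v (N : nat) : R := \sum_(1 <= n < N)
  n%:R * coth (n%:R * a) * sine_coef u n * sine_coef v n.

Definition coth_form u v : R := limn (coth_sum u v).

Lemma coth_sumC u v : coth_sum u v = coth_sum v u.
Proof. by apply/funext => N; apply: eq_bigr => n _; rewrite mulrAC. Qed.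

Lemma coth_sum_linear (c : R) u v w : u \in L2 -> v \in L2 ->
  coth_sum (c *: u + v) w = (fun N => c * coth_sum u w N + coth_sum v w N).
Proof.
move=> lu lv; apply/funext => N.
rewrite /coth_sum mulr_sumr -big_split; apply: eq_bigr => n _ /=.
by rewrite sine_coef_linear//; ring.
Qed.

Lemma coth_term_ge0 u n : 0 <= n%:R * coth (n%:R * a) * sine_coef u n * sine_coef u n.
Proof.
case: n => [|n]; first by rewrite !mul0r.
rewrite -mulrA -expr2 mulr_ge0 ?sqr_ge0// mulr_ge0// coth_ge0//.
by rewrite mulr_gt0.
Qed.

Lemma coth_sum_le u u' N : H10 u u' ->
  coth_sum u u N <= coth a * (2 / pi * dot u' u').
Proof.
move=> hu; have /H10P[_ lu' _] := hu.
have ca := coth_ge0 a0.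
have pi0 : 0 < pi :> R := pi_gt0 R.
case: N => [|N].
  by rewrite /coth_sum big_geq// mulr_ge0// mulr_ge0 ?dotp_ge0// divr_ge0// ltW.
(* Shifting the index from 1 to 0 matches the [n.+1] of [cos_bessel]. *)
rewrite /coth_sum big_add1 /=.
apply: (@le_trans _ _ (\sum_(0 <= n < N) coth a * ((2 / pi) ^+ 2 *
    dot u' (fun x => cos (n.+1%:R * x)) ^+ 2))).
  apply: ler_sum => n _.
  rewrite -exprMn -(H10_sine_coef _ hu) exprMn.
  rewrite -[leLHS]mulrA -expr2 [leRHS]mulrA; apply: ler_wpM2r; first exact: sqr_ge0.
  (* The single factor [n] is enlarged to [n ^+ 2], so that the square of [n * sine_coef u n]
     appears, a cosine coefficient of [u']. *)
  rewrite mulrC; apply: ler_pM => //.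
  - by rewrite coth_ge0// mulr_gt0.
  - by apply: coth_le => //; rewrite ler_peMl ?ler1n// ltW.
  - by rewrite expr2 ler_peMl// ler1n.
rewrite -!mulr_sumr ler_wpM2l//.
apply: le_trans (ler_wpM2l _ (cos_bessel N lu')) _; first exact: sqr_ge0.
rewrite mulrA (_ : (2 / pi) ^+ 2 * (pi / 2) = 2 / pi)//.
by move: pi pi0 => p p0; field; rewrite gt_eqF.
Qed.

Lemma is_cvg_coth_sum_diag u u' : H10 u u' -> cvgn (coth_sum u u).
Proof.
move=> hu; apply: nondecreasing_is_cvgn.
  apply/nondecreasing_seqP => n; rewrite /coth_sum.
  case: n => [|n]; first by rewrite !big_geq.
  by rewrite [leRHS]big_nat_recr//= lerDl coth_term_ge0.
by exists (coth a * (2 / pi * dot u' u')) => _ [N _ <-]; exact: coth_sum_le.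
Qed.

(** Mixed terms have no sign, so monotone convergence applies only on the diagonal; polarization
    reduces to it. *)
Lemma is_cvg_coth_sum u u' v v' : H10 u u' -> H10 v v' -> cvgn (coth_sum u v).
Proof.
move=> hu hv; have /H10P[lu _ _] := hu; have /H10P[lv _ _] := hv.
have huv : H10 (1 *: u + v) (1 *: u' + v') by exact: H10_linear.
have /H10P[luv _ _] := huv.
rewrite (_ : coth_sum u v = (fun N => 2^-1 * (coth_sum (1 *: u + v) (1 *: u + v) N
    - coth_sum u u N - coth_sum v v N))); last first.
  rewrite coth_sum_linear//; apply/funext => N.
  rewrite (coth_sumC u (_ + _)) (coth_sumC v (_ + _)) !coth_sum_linear// (coth_sumC v u).
  by field.
apply: is_cvgMr; apply: is_cvgB; first apply: is_cvgB.
- exact: is_cvg_coth_sum_diag huv.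
- exact: is_cvg_coth_sum_diag hu.
- exact: is_cvg_coth_sum_diag hv.
Qed.

Lemma coth_formC u v : coth_form u v = coth_form v u.
Proof. by rewrite /coth_form coth_sumC. Qed.

Lemma coth_form_linear (c : R) u u' v v' w w' :
  H10 u u' -> H10 v v' -> H10 w w' ->
  coth_form (c *: u + v) w = c * coth_form u w + coth_form v w.
Proof.
move=> hu hv hw; have /H10P[lu _ _] := hu; have /H10P[lv _ _] := hv.
rewrite /coth_form coth_sum_linear//; apply/cvg_lim => //.
by apply: cvgD; [apply: cvgMr; exact: is_cvg_coth_sum hu hw|exact: is_cvg_coth_sum hv hw].
Qed.

Lemma coth_form_ge0 u u' : H10 u u' -> 0 <= coth_form u u.
Proof.
move=> hu; apply: limr_ge; first exact: is_cvg_coth_sum_diag hu.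
by apply: nearW => N; apply: sumr_ge0 => n _; exact: coth_term_ge0.
Qed.

Lemma coth_form_le u u' : H10 u u' ->
  coth_form u u <= coth a * (2 / pi * dot u' u').
Proof.
move=> hu; apply: limr_le; first exact: is_cvg_coth_sum_diag hu.
by apply: nearW => N; exact: coth_sum_le.
Qed.

End coth_form.

Section gap.
Context {R : realType}.
Variable eps : R.
Local Notation mu := (mu0pi R).
Local Notation L2 := (Lfun (mu0pi R) 2%:E).
Local Notation dot := (dotp (mu0pi R)).
Hypothesis eps0 : 0 < eps.
Hypothesis eps1 : eps < 1.

Lemma is_derive_gap (x : R) : is_derive x (1 : R) (gap eps) (- 2 * eps * sin (2 * x)).
Proof.
have := is_derive_cosM 2 x => H; apply: is_derive_eq.
by rewrite /GRing.scale /=; ring.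
Qed.

Lemma gap_bounds (x : R) : 1 - eps <= gap eps x <= 2.
Proof.
rewrite /gap; have := cos_geN1 (2 * x); have := cos_le1 (2 * x).
move: (cos _) eps0 eps1 => c e0 e1 c1 cN1; apply/andP; split; nra.
Qed.

Lemma derive1_gap_L2 : derive1 (gap eps) \in L2.
Proof.
rewrite (_ : derive1 (gap eps) = fun x => - 2 * eps * sin (2 * x)).
  by apply: continuous_L2 => x; apply: cvgM; [exact: cvg_cst|exact: continuous_sinM].
by apply/funext => x; have H := is_derive_gap x; rewrite derive1E derive_val.
Qed.

Lemma gap3_mul_L2 u : u \in L2 -> (fun x => gap eps x ^+ 3 * u x) \in L2.
Proof.
move=> lu; apply: (@bounded_mul_L2 _ _ _ mu _ _ 8) => //.
  apply: measurable_funX; apply: continuous_measurable.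
  exact: is_derive_continuous is_derive_gap.
move=> x; have /andP[g1 g2] := gap_bounds x.
have g0 : 0 <= gap eps x by have := eps1; lra.
rewrite normrX ger0_norm//.
by apply: le_trans (lerXn2r 3 _ _ g2) _; rewrite ?nnegrE//; have := eps1; lra.
Qed.

Lemma gap3_dotp_ge u : u \in L2 ->
  (1 - eps) ^+ 3 * dot u u <= dot (fun x => gap eps x ^+ 3 * u x) u.
Proof.
move=> lu; rewrite /dotp -RintegralZl//; last exact: L2_integrableM.
apply: le_Rintegral => //.
- by have := L2_integrableM (L2_scale ((1 - eps) ^+ 3) lu) lu;
    apply: eq_integrable => // x _ /=; rewrite -mulrA.
- by apply: L2_integrableM => //; exact: gap3_mul_L2.
move=> x _; have /andP[g1 _] := gap_bounds x.
rewrite -mulrA ler_wpM2r -?expr2 ?sqr_ge0//.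
by rewrite lerXn2r ?nnegrE//; have := eps1; lra.
Qed.

Lemma gap3_dotp_le u : u \in L2 ->
  dot (fun x => gap eps x ^+ 3 * u x) u <= 8 * dot u u.
Proof.
move=> lu; rewrite /dotp -RintegralZl//; last exact: L2_integrableM.
apply: le_Rintegral => //.
- by apply: L2_integrableM => //; exact: gap3_mul_L2.
- by have := L2_integrableM (L2_scale 8 lu) lu;
    apply: eq_integrable => // x _ /=; rewrite -mulrA.
move=> x _; have /andP[g1 g2] := gap_bounds x.
rewrite -mulrA ler_wpM2r -?expr2 ?sqr_ge0//.
by apply: le_trans (lerXn2r 3 _ _ g2) _; rewrite ?nnegrE//; have := eps1; lra.
Qed.

End gap.

(** * The variational problem *)

Section energy.
Context {R : realType} (a eps : R).
Hypotheses (a0 : 0 < a) (eps0 : 0 < eps) (eps1 : eps < 1).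
Local Notation mu := (mu0pi R).
Local Notation L2 := (Lfun (mu0pi R) 2%:E).
Local Notation dot := (dotp (mu0pi R)).
Local Notation V := ((R -> R) * (R -> R))%type.

(** The first term reads the derivatives, the second the functions; on pairs both are bilinear, and
    the product space is the module to which Riesz representation is applied. *)
Definition energy (p q : V) : R :=
  dot (fun x => gap eps x ^+ 3 * p.2 x) q.2 + pi / 2 * coth_form a p.1 q.1.

Let H10L2 u u' : H10 u u' -> u \in L2 /\ u' \in L2.
Proof. by move=> /H10P[]. Qed.

Lemma energyC p q : energy p q = energy q p.
Proof.
rewrite /energy coth_formC; congr (_ + _).
by apply: eq_Rintegral => x _; rewrite mulrAC.
Qed.

Lemma energy_linear (c : R) (p q r : V) :
  H10 p.1 p.2 -> H10 q.1 q.2 -> H10 r.1 r.2 ->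
  energy (c *: p + q) r = c * energy p r + energy q r.
Proof.
move=> hp hq hr; rewrite /energy (coth_form_linear a0 c hp hq hr).
have [_ lp] := H10L2 hp; have [_ lq] := H10L2 hq; have [_ lr] := H10L2 hr.
rewrite (_ : (fun x => _) = c *: (fun x => gap eps x ^+ 3 * p.2 x)
   + (fun x => gap eps x ^+ 3 * q.2 x)).
  rewrite dotp_linearl ?gap3_mul_L2//; ring.
apply/funext => x.
rewrite [LHS](_ : _ = gap eps x ^+ 3 * (c * p.2 x + q.2 x))//.
by rewrite [RHS](_ : _ = c * (gap eps x ^+ 3 * p.2 x) + gap eps x ^+ 3 * q.2 x)//; ring.
Qed.

Lemma energy_ge (p : V) : H10 p.1 p.2 -> (1 - eps) ^+ 3 * dot p.2 p.2 <= energy p p.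
Proof.
move=> hp; have [_ lp] := H10L2 hp; apply: le_trans (gap3_dotp_ge eps0 eps1 lp) _.
rewrite /energy lerDl mulr_ge0// ?(coth_form_ge0 a0 hp)//.
by rewrite divr_ge0// ltW// pi_gt0.
Qed.

Lemma energy_le (p : V) : H10 p.1 p.2 -> energy p p <= (8 + coth a) * dot p.2 p.2.
Proof.
move=> hp; have [_ lp] := H10L2 hp.
rewrite /energy [leRHS]mulrDl; apply: lerD; first exact: gap3_dotp_le.
have pi0 : 0 < pi :> R := pi_gt0 R.
have k0 : 0 <= pi / 2 :> R by rewrite divr_ge0// ltW.
apply: le_trans (ler_wpM2l k0 (coth_form_le a0 hp)) _.
rewrite le_eqVlt; apply/predU1P; left; move: (dot _ _) (coth a) => A B.
by move: pi pi0 => p0 p00; field; rewrite gt_eqF.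
Qed.

Let load (p : V) : R := dot (derive1 (gap eps)) p.1.

Lemma load_le : exists2 C, 0 <= C & forall p : V, H10 p.1 p.2 ->
  load p ^+ 2 <= C * energy p p.
Proof.
pose D := dot (derive1 (gap eps)) (derive1 (gap eps)) * (16 * pi ^+ 2).
have e0 : 0 < (1 - eps) ^+ 3 by rewrite exprn_gt0// subr_gt0.
have D0 : 0 <= D by rewrite mulr_ge0 ?dotp_ge0// mulr_ge0// sqr_ge0.
exists (D / (1 - eps) ^+ 3); first by rewrite divr_ge0// ltW.
move=> p hp; have [lp _] := H10L2 hp.
apply: le_trans (dotp_CS (derive1_gap_L2 eps) lp) _.
apply: le_trans (ler_wpM2l (dotp_ge0 mu _) (H10_poincare hp)) _.
rewrite mulrA -/D -[leRHS]mulrA; apply: ler_wpM2l => //.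
by rewrite mulrC ler_pdivlMr// mulrC; exact: energy_ge.
Qed.

Let weak_equation (p : V) := forall q, H10 q.1 q.2 -> energy p q = load q.

Lemma exists_energy_solution : exists2 p : V, H10 p.1 p.2 & weak_equation p.
Proof.
have [C C0 loadC] := load_le.
apply: (@riesz_representation R V (fun p => H10 p.1 p.2) energy load C) => //.
- exact: H10_0.
- by move=> c u v hu hv; exact: H10_linear.
- by move=> u v _ _; exact: energyC.
- by move=> *; exact: energy_linear.
- move=> u hu; apply: le_trans (energy_ge hu).
  by rewrite mulr_ge0 ?dotp_ge0// exprn_ge0// subr_ge0 ltW.
- move=> c u v hu hv; have [lu _] := H10L2 hu; have [lv _] := H10L2 hv.
  rewrite /load dotpC dotp_linearl ?derive1_gap_L2//.
  by rewrite !(dotpC mu _ (derive1 _)).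
move=> v K hv vK.
have e0 : 0 < (1 - eps) ^+ 3 by rewrite exprn_gt0// subr_gt0.
have HB (p q : V) : H10 p.1 p.2 -> H10 q.1 q.2 -> H10 (p - q).1 (p - q).2.
  move=> hp hq; have := H10_linear (-1) hq hp.
  by rewrite !scaleN1r !(addrC (- _)).
(* Coercivity costs the factor [1 / (1 - eps) ^+ 3] on the way to the derivatives; the upper energy
   bound costs [8 + coth a] on the way back. *)
have [|w [w' [hw wC]]] := @H10_complete _ (fst \o v) (snd \o v) (K / (1 - eps) ^+ 3) hv.
  move=> k l kl; rewrite mulrAC ler_pdivlMr// mulrC.
  exact: le_trans (energy_ge (HB _ _ (hv k) (hv l))) (vK k l kl).
exists (w, w') => //; exists ((8 + coth a) * (K / (1 - eps) ^+ 3)) => k.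
apply: le_trans (energy_le (HB _ (w, w') (hv k) hw)) _.
rewrite -[leRHS]mulrA; apply: ler_wpM2l; last exact: wC.
by rewrite addr_ge0// coth_ge0.
Qed.

(** Testing both equations with the difference [r] itself gives it zero energy. Coercivity then
    kills [r.2], Poincare's inequality kills the norm of [r.1], and a null L^2 norm means zero
    almost everywhere. *)
Lemma energy_solution_unique (p q : V) : H10 p.1 p.2 -> H10 q.1 q.2 ->
  weak_equation p -> weak_equation q -> {ae mu, forall x, p.1 x = q.1 x}.
Proof.
move=> hp hq wp wq.
pose r : V := -1 *: q + p.
have hr : H10 r.1 r.2 by exact: H10_linear.
have [lr lr'] := H10L2 hr.
have Er : energy r r = 0 by rewrite {1}/r energy_linear// wp// wq// mulN1r addNr.
have e0 : 0 < (1 - eps) ^+ 3 by rewrite exprn_gt0// subr_gt0.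
have r'0 : dot r.2 r.2 <= 0.
  by rewrite -(ler_pM2l e0) mulr0 -Er; exact: energy_ge.
have r0 : dot r.1 r.1 = 0.
  apply/eqP; rewrite eq_le dotp_ge0 andbT; apply: le_trans (H10_poincare hr) _.
  by rewrite mulr_ge0_le0// mulr_ge0// sqr_ge0.
have := Lnorm2E lr; rewrite r0 sqrtr0 => /Lnorm_eq0_eq0.
have mr := L2_measurable lr.
move=> /(_ ((measurable_EFinP _ _).2 mr)) /(_ ltac:(by rewrite lte_fin)).
apply: filterS => x /(_ I) [rx].
apply/eqP; rewrite -subr_eq0; apply/eqP; rewrite -[RHS]rx.
by rewrite [RHS](_ : _ = - 1 * q.1 x + p.1 x)// mulN1r addrC.
Qed.

(** The convergence clause is supplied by [is_cvg_coth_sum]; the rest is conversion. *)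
Lemma weak_solutionP (P : R -> R) : weak_solution a (gap eps) P <->
  exists P', H10 P P' /\ weak_equation (P, P').
Proof.
split=> [[P' [hP H]]|[P' [hP H]]]; exists P'; split => //.
  by move=> [W W'] /= hW; have [_] := H W W' hW.
move=> W W' hW s; split; first exact: is_cvg_coth_sum hP hW.
exact: (H (W, W') hW).
Qed.

End energy.

Theorem theorem3p3 (R : realType) (a eps : R) (ha : 0 < a) (heps0 : 0 < eps)
    (heps1 : eps < 1) :
  (exists P : R -> R, weak_solution a (gap eps) P) /\
  (forall P Q : R -> R,
     weak_solution a (gap eps) P -> weak_solution a (gap eps) Q ->
     {ae mu0pi R, forall x, P x = Q x}).
Proof.
split.
  have [[P P'] hP wP] := exists_energy_solution ha heps0 heps1.
  by exists P; apply/weak_solutionP => //; exists P'.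
move=> P Q /(weak_solutionP eps ha)[P' [hP wP]] /(weak_solutionP eps ha)[Q' [hQ wQ]].
exact: (@energy_solution_unique _ a eps ha heps0 heps1 (P, P') (Q, Q')).
Qed.
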